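(* Let $\alpha>-1$ and $x>0$ be real, and let $(e_n)_{n\ge 0}$ be the error sequence of the three-term recurrence for the generalized Laguerre polynomials at $x$, i.e. $$e_{n+1}=\frac{2n+\alpha+1-x}{n+1}\,e_n-\frac{n+\alpha}{n+1}\,e_{n-1}+\zeta_n\quad(n\ge 1),\qquad e_0=0,\qquad e_1=\mathcal{L}_1^{(\alpha)}(x)\,\eta_0^a,$$ where $\zeta_n$ is the round-off term defined in the context. Write $\max\{|e_1|,|\zeta_s|\}$ for the maximum of $|e_1|$ and all $|\zeta_s|$, $1\le s\le n$. Then for all $n\ge1$: (i) If $-1<\alpha\le 1/4$ and $x<1/4$, then $$|e_{n+1}|\le\sqrt{\frac{1}{|x|}\Big((1+\alpha+x)e_1^2+\frac{2(n+1)(n+2)(2n+3)}{3}\max_{1\le s\le n}\zeta_s^2\Big)}\le\Big(2+\frac{2(n+2)^{3/2}}{\sqrt3}\Big)\frac{\max\{|e_1|,|\zeta_s|\}}{|x|^{1/2}} .$$ (ii) If $\alpha\ge 0$ and $\eta>0$ satisfy $3-\alpha-x-\eta>0$ and $-1.5\le 1-2\alpha-x-\eta<0$, then, with $$\beta_n:=\frac{\Gamma(n+2+\alpha)/\Gamma(2+\alpha)}{\Gamma(n+3-\alpha-x-\eta)/\Gamma(3-\alpha-x-\eta)},$$ one has $$|e_{n+1}|\le\sqrt{\frac{1}{|x|}\Big[\beta_n(1+\alpha+x)e_1^2+\frac{29\beta_n+(n-3)(n+1)^2}{\eta}\max_{1\le s\le n}\zeta_s^2\Big]}\le\Big(2\sqrt{\beta_n}+\frac{5.5\sqrt{\beta_n}+n^{1/2}(n+1)}{\sqrt{\eta}}\Big)\frac{\max\{|e_1|,|\zeta_s|\}}{|x|^{1/2}},$$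 and, for fixed $\alpha,x,\eta$, $\beta_n=O\big((n+1+\alpha)^{2\alpha+x+\eta-1}\big)$ as $n\to\infty$. (iii) In particular, for $\alpha=1$ and $x<1/4$ (taking $\eta=1/4$), $$|e_{n+1}|\le\big(O(n^{3/4})+O(n^{3/2})\big)\frac{\max\{|e_1|,|\zeta_s|\}}{|x|^{1/2}}= O(n^{3/2})\,\frac{\max\{|e_1|,|\zeta_s|\}}{|x|^{1/2}},$$ where the implied constants do not depend on $n$, on $x$, or on the round-off errors.
   Context: For $\alpha>-1$, the generalized Laguerre polynomials $\mathcal{L}_n^{(\alpha)}$ are defined by $\mathcal{L}_0^{(\alpha)}(x)=1$, $\mathcal{L}_1^{(\alpha)}(x)=-x+\alpha+1$, and $(n+1)\mathcal{L}_{n+1}^{(\alpha)}(x)=(2n+\alpha+1-x)\mathcal{L}_n^{(\alpha)}(x)-(n+\alpha)\mathcal{L}_{n-1}^{(\alpha)}(x)$ for $n\ge 1$; they are considered for $x\in\mathbb{R}_+=(0,+\infty)$. Round-off model: the real numbers $\eta_x$, $\eta_n^a$, $\eta_n^b$ are the relative round-off errors of the corresponding coefficients of the recurrence, and $\eta_0^a$ is the relative error of the computed value of $\mathcal{L}_1^{(\alpha)}(x)$ (all of the order of the relative round-off bound $\varepsilon$ of the floating-point system). The computed values are $\mathcal{L}_n^{(\alpha)}(x)+e_n$, where $e_n$ is the (absolute) error, and they satisfy, for $n\ge 1$, $$\mathcal{L}_{n+1}^{(\alpha)}+e_{n+1}=\frac{2n+\alpha+1-x(1+\eta_x)}{n+1}(1+\eta_n^a)(\mathcal{L}_n^{(\alpha)}+e_n)-\frac{n+\alpha}{n+1}(1+\eta_n^b)(\mathcal{L}_{n-1}^{(\alpha)}+e_{n-1}),$$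 all polynomials being evaluated at $x$. Equivalently, $e_n$ satisfies the recurrence displayed in the claim with $$\zeta_n=\xi_n-\frac{x}{n+1}\mathcal{L}_n^{(\alpha)}\eta_x+\frac{2n+\alpha+1-x}{n+1}\mathcal{L}_n^{(\alpha)}\eta_n^a-\frac{n+\alpha}{n+1}\mathcal{L}_{n-1}^{(\alpha)}\eta_n^b,$$ where $\xi_n$ collects the remaining (higher-order) terms, namely $$\xi_n=-\frac{x}{n+1}\eta_x\big[(1+\eta_n^a)(\mathcal{L}_n^{(\alpha)}+e_n)-\mathcal{L}_n^{(\alpha)}\big]+\frac{2n+\alpha+1-x}{n+1}\eta_n^a e_n-\frac{n+\alpha}{n+1}\eta_n^b e_{n-1}.$$ $\Gamma$ denotes the Gamma function. *)

(* Defs.v *)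
From HB Require Import structures.
From mathcomp Require Export all_boot all_order all_algebra.
From mathcomp Require Export all_classical all_reals all_analysis.

Set Implicit Arguments.
Unset Strict Implicit.
Unset Printing Implicit Defensive.

Import Order.TTheory GRing.Theory Num.Theory.
Import numFieldNormedType.Exports.

Local Open Scope classical_set_scope.
Local Open Scope ring_scope.

(* Euler's integral, which converges for s > 0; it is only used there. *)
Definition Gamma (R : realType) (s : R) : R :=
  \int[lebesgue_measure]_(t in `]0, +oo[) (t `^ (s - 1) * expR (- t)).

Section Laguerre.
Context {R : realType}.
Implicit Types (alpha x eta : R) (n : nat).

(* The third branch is the recurrence for L_{m+1} in terms of L_m and
   L_k = L_{m-1}, for m >= 1. *)
Fixpoint laguerre alpha n : {poly R} :=
  match n with
  | 0%N => 1
  | 1%N => - 'X + (alpha + 1)%:P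
  | (k.+1 as m).+1 =>
      m.+1%:R^-1 *: (((2 * m%:R + alpha + 1)%:P - 'X) * laguerre alpha m
                     - (m%:R + alpha) *: laguerre alpha k)
  end.

(* The round-off errors are etax, etaa n, etab n, and e is the sequence of
   absolute errors.  Both xi and zeta are only meaningful for n >= 1. *)
Definition xi alpha x (etax : R) (etaa etab e : nat -> R) n : R :=
  - (x / n.+1%:R * etax *
      ((1 + etaa n) * ((laguerre alpha n).[x] + e n) - (laguerre alpha n).[x]))
  + (2 * n%:R + alpha + 1 - x) / n.+1%:R * etaa n * e n
  - (n%:R + alpha) / n.+1%:R * etab n * e n.-1.

Definition zeta alpha x (etax : R) (etaa etab e : nat -> R) n : R :=
  xi alpha x etax etaa etab e n
  - x / n.+1%:R * (laguerre alpha n).[x] * etax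
  + (2 * n%:R + alpha + 1 - x) / n.+1%:R * (laguerre alpha n).[x] * etaa n
  - (n%:R + alpha) / n.+1%:R * (laguerre alpha n.-1).[x] * etab n.

Definition error_sequence alpha x (etax : R) (etaa etab e : nat -> R) : Prop :=
  [/\ e 0%N = 0,
      e 1%N = (laguerre alpha 1).[x] * etaa 0%N &
      forall n, (1 <= n)%N ->
        e n.+1 = (2 * n%:R + alpha + 1 - x) / n.+1%:R * e n
                 - (n%:R + alpha) / n.+1%:R * e n.-1
                 + zeta alpha x etax etaa etab e n].

(* The default value 0 is harmless: the terms are nonnegative. *)
Definition max_sqr (z : nat -> R) n : R :=
  \big[Num.max/0]_(1 <= s < n.+1) z s ^+ 2.

(* The maximum of |e_1| and of the |z_s| for 1 <= s <= n. *)
Definition max_err (e z : nat -> R) n : R :=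
  \big[Num.max/`|e 1%N|]_(1 <= s < n.+1) `|z s|.

Definition beta alpha x eta n : R :=
  (Gamma (n%:R + 2 + alpha) / Gamma (2 + alpha)) /
  (Gamma (n%:R + 3 - alpha - x - eta) / Gamma (3 - alpha - x - eta)).

End Laguerre.

(* Main.v *)
Require Import Defs.
From HB Require Import structures.
From mathcomp Require Import all_boot all_order all_algebra.
From mathcomp Require Import all_classical all_reals all_analysis.
From mathcomp Require Import measurable_realfun ring lra.

Set Implicit Arguments.
Unset Strict Implicit.
Unset Printing Implicit Defensive.

Import Order.TTheory GRing.Theory Num.Theory.
Import numFieldNormedType.Exports.

Local Open Scope classical_set_scope.
Local Open Scope ring_scope.

(* Put d_n = e_n - e_(n-1).  The recurrence reads
     (n+1) d_(n+1) = (n+alpha) d_n - x e_n + (n+1) zeta_n,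
   and multiplying it by 2 d_(n+1) bounds the growth of the energy
   E_n = x e_n^2 + (n+alpha) d_n^2:
     E_(n+1) <= E_n + (x+2alpha-1) d_(n+1)^2 + 2 (n+1) zeta_n d_(n+1).
   In case (i) the coefficient x+2alpha-1 is at most -1/4 and absorbs the
   round-off term, so E_(n+1) <= E_n + 4 (n+1)^2 zeta_n^2.  In case (ii), with
   g = 2alpha+x+eta-1 > 0, the term g d_(n+1)^2 is at most
   g/(n+1+alpha) E_(n+1), so each step multiplies the energy by at most
   1/(1 - g/(n+1+alpha)); by the functional equation of Gamma the product of
   these factors is beta_n, and the round-off terms contribute the sum of the
   (s+1)^2 beta_n/beta_(s-1), 1 <= s <= n, which is at most
   29 beta_n + (n-3) (n+1)^2. *)

(** * Functional equation, finiteness and positivity of the Gamma function *)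

Section GammaFunction.
Context {R : realType}.
Implicit Types (s : R) (n : nat).
Notation mu := (@lebesgue_measure R).

Definition gamma_integrand s (t : R) : R := t `^ (s - 1) * expR (- t).

(** Compact intervals exhausting the half-line; the shifts make them nondegenerate already for
    [n = 0]. *)
Definition gamma_itv n : set R := `[n.+1%:R^-1, n.+2%:R].

Let gamma_integrand_ge0 s t : 0 <= gamma_integrand s t.
Proof. by rewrite mulr_ge0 ?powR_ge0 ?expR_ge0. Qed.

Let measurable_gamma_integrand s (D : set R) :
  measurable_fun D (fun t => (gamma_integrand s t)%:E).
Proof.
apply/measurable_EFinP; apply: measurable_funTS; apply: measurable_funM.
  exact: measurable_powR.
by apply: measurableT_comp => //; exact: measurable_expR.
Qed.

Lemma derivable_oo_LRcontinuous_derivable (F : R -> R) (a b : R) : a < b ->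
  {in `[a, b], forall x, derivable F x 1} -> derivable_oo_LRcontinuous F a b.
Proof.
move=> ab dF; have /(continuous_within_itvP F ab)[_ Fa Fb] :=
  derivable_within_continuous dF.
by split => // x xab; apply: dF; exact: subset_itv_oo_cc.
Qed.

Lemma bigcup_gamma_itv : \bigcup_n gamma_itv n = `]0, +oo[%classic.
Proof.
apply/seteqP; split => [x [n _]|x]; rewrite /gamma_itv /= !in_itv /= andbT.
  by move=> /andP[+ _]; apply: lt_le_trans; rewrite invr_gt0.
move=> x0; have [N _ NP] := near_infty_natSinv_lt (PosNum x0).
have [M MP] : exists M : nat, x <= M%:R.
  by exists (Num.truncn x).+1; rewrite ltW// truncnS_gt.
exists (maxn N M) => //; rewrite /gamma_itv /= in_itv /=; apply/andP; split.
  by apply: ltW; apply: NP => /=; exact: leq_maxl.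
by apply: le_trans MP _; rewrite ler_nat; apply: leqW; apply: leqW; exact: leq_maxr.
Qed.

Lemma cvg_gamma_integral s :
  (\int[mu]_(t in gamma_itv n) (gamma_integrand s t)%:E @[n --> \oo] -->
   \int[mu]_(t in `]0%R, +oo[) (gamma_integrand s t)%:E)%E.
Proof.
rewrite -bigcup_gamma_itv; apply: ge0_nondecreasing_set_cvg_integral.
- apply/nondecreasing_seqP => n; apply/subsetPset; apply: subset_itv => //=.
    by rewrite bnd_simp lef_pV2 ?posrE// ler_nat.
  by rewrite bnd_simp ler_nat.
- by move=> i; exact: measurable_itv.
- by move=> i; exact: measurable_gamma_integrand.
- by move=> i x _; rewrite lee_fin.
Qed.

Lemma is_derive_expRN (t : R) : is_derive t 1 (fun u => - expR (- u)) (expR (- t)).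
Proof.
have d : is_derive t 1 (expR \o -%R) (expR (- t) * -1) by exact: is_derive1_comp.
by apply: is_derive_eq; rewrite mulrN1 opprK.
Qed.

(** Integration by parts with [t ^ s] and the antiderivative [- exp (- t)]; as [a > 0], both are
    differentiable up to the endpoints. *)
Lemma gamma_by_parts s (a b : R) : 0 < a -> a < b ->
  (\int[mu]_(t in `[a, b]) (gamma_integrand (s + 1) t)%:E =
   (a `^ s * expR (- a) - b `^ s * expR (- b))%:E
   + s%:E * \int[mu]_(t in `[a, b]) (gamma_integrand s t)%:E)%E.
Proof.
move=> a0 ab.
have pos t : t \in `[a, b] -> 0 < t.
  by rewrite in_itv/= => /andP[at_ _]; exact: lt_le_trans at_.
have posoo t : t \in `]a, b[ -> 0 < t by move=> /subset_itv_oo_cc/pos.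
pose G t : R := - expR (- t).
have cE : {within `[a, b], continuous (fun t : R => expR (- t))}.
  apply: continuous_subspaceT => t.
  by apply: continuous_comp; [exact: continuousN|exact: continuous_expR].
have dP r t : 0 < t -> derivable (fun u : R => u `^ r) t 1.
  by move=> t0; apply: derivable_powR; rewrite in_itv/= andbT.
have cF r : {within `[a, b], continuous (fun t : R => t `^ r)}.
  by apply: derivable_within_continuous => t /pos; exact: dP.
have dF r : derivable_oo_LRcontinuous (fun t : R => t `^ r) a b.
  by apply: derivable_oo_LRcontinuous_derivable => // t /pos; exact: dP.
have dG : derivable_oo_LRcontinuous G a b.
  by apply: derivable_oo_LRcontinuous_derivable.
have cFd : {within `[a, b], continuous (fun t : R => s * t `^ (s - 1))}.
  apply: derivable_within_continuous => t /pos/dP d.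
  by apply: derivableM; [exact: derivable_cst|exact: d].
have := @integration_by_parts R (fun t : R => t `^ s) G _ _ a b ab cFd (dF s) _ cE dG _.
have -> : (fun t => (gamma_integrand (s + 1) t)%:E) =
          (fun t => (t `^ s * expR (- t))%:E).
  by apply/funext => t; rewrite /gamma_integrand addrK.
move=> -> //; last 2 first.
- move=> t /posoo t0; rewrite derive1E.
  exact: (@derive_val _ _ _ _ _ _ _ (is_derive1_powR s t0)).
- move=> t _; rewrite derive1E.
  exact: (@derive_val _ _ _ _ _ _ _ (is_derive_expRN t)).
congr (_ + _)%E; first by rewrite /G; congr EFin; ring.
have mI : measurable_fun `[a, b] (fun t => (gamma_integrand s t)%:E).
  exact: measurable_gamma_integrand.
have igI : mu.-integrable `[a, b] (fun t => (gamma_integrand s t)%:E).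
  apply: continuous_compact_integrable; first exact: segment_compact.
  apply: derivable_within_continuous => t /pos/dP d.
  by apply: derivableM; [exact: d|].
have -> : (fun t => (s * t `^ (s - 1) * G t)%:E) =
          (fun t => (- s)%:E * (gamma_integrand s t)%:E)%E.
  by apply/funext => t; rewrite -EFinM /G /gamma_integrand; congr EFin; ring.
by rewrite integralZl// EFinN mulNe oppeK.
Qed.

Lemma cvg_gamma_boundary s : 0 < s ->
  n.+1%:R^-1 `^ s * expR (- n.+1%:R^-1) - n.+2%:R `^ s * expR (- n.+2%:R)
    @[n --> \oo] --> (0 : R).
Proof.
move=> s0; rewrite -[0 in X in _ --> X]subr0; apply: cvgB.
  rewrite -[0 in X in _ --> X](mul0r (expR (- 0))); apply: cvgM.
    have /cvg_at_rightP := @powR_cvg0 R s s0; apply; split.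
      by move=> n; rewrite invr_gt0.
    exact: cvg_harmonic.
  have c : {for 0, continuous (fun x : R => expR (- x))}.
    by apply: continuous_comp; [exact: continuousN|exact: continuous_expR].
  exact: (cvg_comp _ _ (@cvg_harmonic R) c).
have [k sk] : exists k : nat, s <= k%:R.
  by exists (Num.truncn s).+1; rewrite ltW// truncnS_gt.
(* With [b = n + 2], the inequalities [b ^ s <= b ^ k] and [b ^ (k+1) / (k+1)! <= exp b] give
   [b ^ s exp (- b) <= (k+1)! / b]. *)
apply: (@squeeze_cvgr _ _ _ _ (cst 0) (fun n => k.+1`!%:R * harmonic n.+1)).
- apply: nearW => n; set b : R := n.+2%:R; have b0 : 0 < b by [].
  rewrite mulr_ge0 ?powR_ge0 ?expR_ge0//= /harmonic -/b.
  have bk : b ^+ k.+1 / k.+1`!%:R <= expR b.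
    apply: le_trans (expR_ge1Dxn k (ltW b0)); by rewrite lerDr.
  rewrite expRN ler_pdivrMr ?expR_gt0//.
  have -> : k.+1`!%:R / b * expR b = k.+1`!%:R * expR b / b by rewrite mulrAC.
  rewrite ler_pdivlMr//; apply: (@le_trans _ _ (b ^+ k * b)).
    rewrite ler_pM2r// -powR_mulrn ?(ltW b0)//; apply: ler_powR => //.
    by rewrite /b ler1n.
  by rewrite -exprSr mulrC -ler_pdivrMr // ltr0n fact_gt0.
- exact: cvg_cst.
- rewrite -[0 in X in _ --> X](mulr0 k.+1`!%:R); apply: cvgMr.
  by rewrite (cvg_shiftS (@harmonic R)); exact: cvg_harmonic.
Qed.

(** Extended-real valued, so that the functional equation can be proved before finiteness, and then
    used to prove finiteness. *)
Definition gamma_int s : \bar R :=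
  (\int[mu]_(t in `]0%R, +oo[) (gamma_integrand s t)%:E)%E.

Lemma gamma_intS s : 0 < s -> gamma_int (s + 1) = (s%:E * gamma_int s)%E.
Proof.
move=> s0; apply: (cvg_unique _ (@cvg_gamma_integral (s + 1))) => //.
suff : (\int[mu]_(t in gamma_itv n) (gamma_integrand (s + 1) t)%:E @[n --> \oo]
         --> (s%:E * gamma_int s)%E)%E by [].
rewrite -[X in _ --> X]add0e.
have ab n : n.+1%:R^-1 < n.+2%:R :> R.
  by apply: (@le_lt_trans _ _ 1); rewrite ?invf_le1 ?ler1n ?ltr1n.
under eq_cvg => n do rewrite (gamma_by_parts _ _ (ab n)) ?invr_gt0//.
apply: cvgeD; first by rewrite fin_num_adde_defr.
  by apply: cvg_EFin; [exact: nearW|exact: cvg_gamma_boundary].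
by apply: cvgeZl => //; exact: cvg_gamma_integral.
Qed.

Lemma gamma_int_ge0 s : (0 <= gamma_int s)%E.
Proof. by apply: integral_ge0 => t _; rewrite lee_fin. Qed.

Lemma gamma_int1_lty : (gamma_int 1 < +oo)%E.
Proof.
apply: (@le_lt_trans _ _ (\int[mu]_(t in `[0%R, +oo[) (expR (- t))%:E)%E).
  rewrite /gamma_int.
  under eq_integral => t _ do rewrite /gamma_integrand subrr powRr0 mul1r.
  apply: ge0_subset_integral => //.
  - apply/measurable_EFinP; apply: measurable_funTS.
    by apply: measurableT_comp => //; exact: measurable_expR.
  - by apply: subset_itv; rewrite bnd_simp.
have cE : continuous (fun t : R => expR (- t)).
  by move=> t; apply: continuous_comp; [exact: continuousN|exact: continuous_expR].
rewrite (@ge0_continuous_FTC2y _ _ (fun t => - expR (- t)) _ 0).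
- by rewrite -EFinB ltry.
- by move=> t _; rewrite expR_ge0.
- exact: continuous_subspaceT.
- rewrite -[0 in X in _ --> X]oppr0; apply: cvgN; exact: cvgr_expR.
- move=> t _; exact: (@ex_derive _ _ _ _ _ _ _ (is_derive_expRN t)).
- apply: cvg_at_right_filter; apply: cvgN; exact: cE.
- move=> t _; rewrite derive1E.
  exact: (@derive_val _ _ _ _ _ _ _ (is_derive_expRN t)).
Qed.

Lemma gamma_int_nat_lty n : (gamma_int n.+1%:R < +oo)%E.
Proof.
elim: n => [|n IH]; first exact: gamma_int1_lty.
by rewrite -(natr1 n.+1) gamma_intS// lte_mul_pinfty.
Qed.

(** For [r >= 1] and a natural [k >= r - 1], [t ^ (r-1) <= 1 + t ^ k] on the half-line (compare with
    1 when [t <= 1], with [t ^ k] otherwise). For [s > 0], the functional equation carries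
    finiteness from [s + 1] back to [s]. *)
Lemma gamma_int_lty s : 0 < s -> (gamma_int s < +oo)%E.
Proof.
have large r : 1 <= r -> (gamma_int r < +oo)%E.
  move=> r1; have [k rk] : exists k : nat, r - 1 <= k%:R.
    by exists (Num.truncn (r - 1)).+1; rewrite ltW// truncnS_gt.
  apply: (@le_lt_trans _ _ (gamma_int 1 + gamma_int k.+1%:R)%E); last first.
    by rewrite lte_add_pinfty// ?gamma_int1_lty// gamma_int_nat_lty.
  rewrite /gamma_int -ge0_integralD//=; last 4 first.
  - by move=> t _; rewrite lee_fin.
  - exact: measurable_gamma_integrand.
  - by move=> t _; rewrite lee_fin.
  - exact: measurable_gamma_integrand.
  apply: ge0_le_integral => //=.
  - by move=> t _; rewrite lee_fin.
  - exact: measurable_gamma_integrand.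
  - by apply: emeasurable_funD; exact: measurable_gamma_integrand.
  - move=> t; rewrite in_itv/= andbT => t0; rewrite -EFinD lee_fin.
    rewrite /gamma_integrand -mulrDl ler_pM2r ?expR_gt0//.
    rewrite subrr powRr0 -natr1 addrK.
    have [t1|t1] := leP t 1.
      apply: ler_wpDr; first exact: powR_ge0.
      apply: (@le_trans _ _ (t `^ 0)); last by rewrite powRr0.
      by apply: ger_powR; [rewrite t0|rewrite subr_ge0].
    by apply: ler_wpDl => //; apply: ler_powR => //; exact: ltW.
move=> s0; have := large (s + 1); rewrite gamma_intS// lerDr => /(_ (ltW s0)).
case: (gamma_int s) (gamma_int_ge0 s) => [r| |] // _; rewrite ?ltry//.
by rewrite gt0_muley ?lte_fin.
Qed.

(** On [[1, 2]], [t ^ (s-1) >= 1 / t >= 1/2] and [exp (- t) >= exp (- 2)]. *)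
Lemma gamma_int_gt0 s : 0 < s -> (0 < gamma_int s)%E.
Proof.
move=> s0; pose c : R := 2^-1 * expR (- 2).
have c0 : 0 < c by rewrite mulr_gt0// expR_gt0.
apply: (@lt_le_trans _ _ (\int[mu]_(t in `[1%R, 2%R]) (cst c%:E t))%E).
  rewrite integral_cst; last exact: measurable_itv.
  rewrite [X in (_ * X)%E](_ : _ = 1%:E); last first.
    have := lebesgue_measure_itv `[1 : R, 2 : R].
    by rewrite /= lte_fin ltr1n -EFinB /= addrK => <-.
  by rewrite mule1 lte_fin.
apply: (@le_trans _ _ (\int[mu]_(t in `[1%R, 2%R]) (gamma_integrand s t)%:E)%E).
  apply: ge0_le_integral => //=.
  - by move=> t _; rewrite lee_fin ltW.
  - exact: measurable_gamma_integrand.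
  - move=> t; rewrite in_itv/= => /andP[t1 t2]; rewrite lee_fin.
    apply: ler_pM; rewrite ?expR_ge0//; last by rewrite ler_expR lerN2.
    apply: (@le_trans _ _ (t `^ (- 1))).
      by rewrite powR_inv1 ?lef_pV2 ?posrE//; lra.
    by apply: ler_powR => //; lra.
apply: ge0_subset_integral => //.
- exact: measurable_gamma_integrand.
- by move=> t _; rewrite lee_fin.
- by apply: subset_itv; rewrite bnd_simp.
Qed.

Lemma Gamma_gt0 s : 0 < s -> 0 < Gamma s.
Proof.
by move=> s0; apply: fine_gt0; rewrite gamma_int_gt0// gamma_int_lty.
Qed.

Lemma GammaS s : 0 < s -> Gamma (s + 1) = s * Gamma s.
Proof.
move=> s0; rewrite /Gamma /Rintegral -[X in fine X]/(gamma_int (s + 1)).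
by rewrite gamma_intS// fineM// fin_numElt (lt_le_trans _ (gamma_int_ge0 s)) ?gamma_int_lty.
Qed.
End GammaFunction.

(** * Growth of the energy along the perturbed recurrence *)

Section Energy.
Context {R : realType}.
Variables (alpha x : R) (e z : nat -> R).

(** Only [k >= 1] matters; at [k = 0] the truncated predecessor makes the difference vanish. *)
Definition energy k : R := x * e k ^+ 2 + (k%:R + alpha) * (e k - e k.-1) ^+ 2.

Definition three_term := forall n, (1 <= n)%N ->
  e n.+1 = (2 * n%:R + alpha + 1 - x) / n.+1%:R * e n
           - (n%:R + alpha) / n.+1%:R * e n.-1 + z n.

Lemma energy1 : e 0%N = 0 -> energy 1 = (1 + alpha + x) * e 1%N ^+ 2.
Proof. by move=> e0; rewrite /energy /= e0; ring. Qed.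

Lemma error_sqr_le_energy n : -1 < alpha -> 0 < x ->
  e n.+1 ^+ 2 <= x^-1 * energy n.+1.
Proof.
move=> a1 x0; have u0 : 0 <= n.+1%:R + alpha.
  by rewrite -(natr1 n); have n0 : 0 <= n%:R :> R by []; lra.
by rewrite [leRHS]mulrC ler_pdivlMr// [leLHS]mulrC /energy lerDl mulr_ge0 ?sqr_ge0.
Qed.

Lemma energy_step n : -1 < alpha -> three_term -> (1 <= n)%N ->
  energy n.+1 <= energy n + (x + 2 * alpha - 1) * (e n.+1 - e n) ^+ 2
                 + 2 * n.+1%:R * z n * (e n.+1 - e n).
Proof.
move=> a1 e_rec n1; have := e_rec _ n1.
have n1R : 1 <= n%:R :> R by rewrite ler1n.
rewrite /energy -(natr1 n) /=.
move: (n%:R : R) n1R (e n.-1) (e n) (e n.+1) (z n) => m m1 a b c w h.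
(* The recurrence in terms of the differences [b - a] and [c - b]. *)
have rel : x * b = (m + alpha) * (b - a) - (m + 1) * (c - b) + (m + 1) * w.
  by rewrite h; field; lra.
rewrite -subr_ge0.
(* The slack is [m + alpha] times the square of the second difference, plus a multiple of the
   residual of [rel], which is zero. *)
have -> : x * b ^+ 2 + (m + alpha) * (b - a) ^+ 2 +
    (x + 2 * alpha - 1) * (c - b) ^+ 2 + 2 * (m + 1) * w * (c - b) -
    (x * c ^+ 2 + (m + 1 + alpha) * (c - b) ^+ 2) =
  (m + alpha) * ((c - b) - (b - a)) ^+ 2 + 2 * (c - b) *
    ((m + alpha) * (b - a) - (m + 1) * (c - b) + (m + 1) * w - x * b) by ring.
rewrite -rel subrr mulr0 addr0 mulr_ge0 ?sqr_ge0//; lra.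
Qed.

(** The coefficient of [M] is the closed form of the sum of [4 (s+1)^2] over [1 <= s <= n]; the
    [- 4] removes the term [s = 0]. *)
Lemma energy_le_contractive M n : -1 < alpha -> three_term ->
  x + 2 * alpha - 1 <= - (1 / 4) ->
  (forall s, (1 <= s <= n)%N -> z s ^+ 2 <= M) ->
  energy n.+1 <= energy 1 +
    (2 * (n%:R + 1) * (n%:R + 2) * (2 * n%:R + 3) / 3 - 4) * M.
Proof.
move=> a1 e_rec xa; elim: n => [_|n IH zM].
  by have -> : energy 1 + (2 * (0%:R + 1) * (0%:R + 2) * (2 * 0%:R + 3) / 3 - 4) * M
    = energy 1 by field.
have {}IH := IH (fun s h => zM s ltac:(by case/andP: h => -> /leqW)).
have := energy_step a1 e_rec (ltn0Sn n); have := zM n.+1; rewrite leqnn => /(_ isT).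
move: IH; rewrite -(natr1 n.+1) -(natr1 n).
move: (energy _) (energy _) (energy _) (e n.+2 - _).
move=> E0 E1 E2 d; have : 0 <= n%:R :> R by []; move: (n%:R : R) (z _) => m w m0 IH wM step.
(* Completing the square: the difference of the two sides is [(2 (m+2) w - d/2)^2]. *)
have sqr1 : 2 * (m + 1 + 1) * w * d - (1 / 4) * d ^+ 2 <= 4 * (m + 2) ^+ 2 * w ^+ 2.
  by rewrite -subr_ge0; have ? := sqr_ge0 (2 * (m + 2) * w - d / 2); lra.
have sqr2 : 4 * (m + 2) ^+ 2 * w ^+ 2 <= 4 * (m + 2) ^+ 2 * M.
  by apply: ler_wpM2l => //; rewrite mulr_ge0 ?sqr_ge0.
have sqr3 : (x + 2 * alpha - 1) * d ^+ 2 <= - (1 / 4) * d ^+ 2.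
  by apply: ler_wpM2r => //; rewrite sqr_ge0.
rewrite [X in _ + X * M](_ : _ = (2 * (m + 1) * (m + 2) * (2 * m + 3) / 3 - 4) +
   4 * (m + 2) ^+ 2); last by field.
by lra.
Qed.

(* Cauchy's inequality [2 (n+1) z d <= (n+1)^2 z^2 / eta + eta d^2] absorbs the
   round-off term; the remaining multiple of [d^2] is a multiple of
   [energy n.+1], which is moved to the left-hand side. *)
Lemma energy_step_expansive eta n : -1 < alpha -> 0 < x -> three_term ->
  (1 <= n)%N -> 0 < eta ->
  0 <= x + 2 * alpha - 1 + eta ->
  (1 - (2 * alpha + x + eta - 1) / (n%:R + 1 + alpha)) * energy n.+1
    <= energy n + (n%:R + 1) ^+ 2 / eta * z n ^+ 2.
Proof.
move=> a1 x0 e_rec n1 eta0 g0; have := energy_step a1 e_rec n1.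
set g := 2 * alpha + x + eta - 1.
rewrite {2 3}/energy /=; have n1R : 1 <= n%:R :> R by rewrite ler1n.
set d := e n.+1 - e n; rewrite -(natr1 n); set m : R := n%:R.
have u0 : 0 < m + 1 + alpha by rewrite /m; lra.
have dE : g * d ^+ 2 <= g / (m + 1 + alpha) * energy n.+1.
  rewrite -mulrA; apply: ler_wpM2l; first by rewrite /g; lra.
  rewrite mulrC ler_pdivlMr// /energy /= -/d -(natr1 n) -/m mulrC lerDr.
  by rewrite mulr_ge0 ?sqr_ge0// ltW.
have cs : 2 * (m + 1) * z n * d <= (m + 1) ^+ 2 / eta * z n ^+ 2 + eta * d ^+ 2.
  rewrite -subr_ge0.
  have -> : (m + 1) ^+ 2 / eta * z n ^+ 2 + eta * d ^+ 2 - 2 * (m + 1) * z n * d =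
    ((m + 1) * z n - eta * d) ^+ 2 / eta by field; lra.
  by rewrite divr_ge0 ?sqr_ge0// ltW.
move: dE cs; rewrite /energy /= -/d -(natr1 n) -/m /g => *; lra.
Qed.

End Energy.

(** * The product of the damping factors and the weighted round-off sum *)

Section Decay.
Context {R : realType}.
Implicit Types (a g : R) (k n : nat).

(** Factor [i] belongs to the step [n = i + 1] of the recurrence. For [g = 2 alpha + x + eta - 1]
    the product is the inverse of [beta]. *)
Definition decay a g k : R := \prod_(i < k) (1 - g / (i%:R + 2 + a)).

Definition decay_sum a g k : R := \sum_(i < k) (i%:R + 2) ^+ 2 * decay a g i.

Lemma decay0 a g : decay a g 0 = 1.
Proof. by rewrite /decay big_ord0. Qed.

Lemma decayS a g k : decay a g k.+1 = decay a g k * (1 - g / (k%:R + 2 + a)).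
Proof. by rewrite /decay big_ord_recr. Qed.

Lemma decay_sumS a g k :
  decay_sum a g k.+1 = decay_sum a g k + (k%:R + 2) ^+ 2 * decay a g k.
Proof. by rewrite /decay_sum big_ord_recr. Qed.

Lemma decay_factor_bounds a g k : 0 <= a -> 0 <= g -> g <= 3 / 2 ->
  0 < 1 - g / (k%:R + 2 + a) <= 1.
Proof.
move=> a0 g0 g1; have k0 : 0 <= k%:R :> R by [].
have u0 : 0 < k%:R + 2 + a by lra.
rewrite subr_gt0 ltr_pdivrMr// mul1r lerBlDr lerDl divr_ge0 ?(ltW u0)// andbT; lra.
Qed.

Lemma decay_gt0 a g k : 0 <= a -> 0 <= g -> g <= 3 / 2 -> 0 < decay a g k.
Proof.
move=> a0 g0 g1; elim: k => [|k IH]; first by rewrite decay0.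
by rewrite decayS mulr_gt0//; case/andP: (decay_factor_bounds k a0 g0 g1).
Qed.

Lemma decayS_le a g k : 0 <= a -> 0 <= g -> g <= 3 / 2 ->
  decay a g k.+1 <= decay a g k.
Proof.
move=> a0 g0 g1; rewrite decayS ler_piMr ?(ltW (decay_gt0 _ _ _ _))//.
by case/andP: (decay_factor_bounds k a0 g0 g1).
Qed.

(** Its nonnegativity is the bound [29 beta_k + (k-3) (k+1)^2] on the round-off sum, divided by
    [beta_k]. *)
Definition decay_gap a g k : R :=
  29 + (k%:R - 3) * (k%:R + 1) ^+ 2 * decay a g k - decay_sum a g k.

(** Without [g], the increment is [decay a g k] times [(k-3) ((k+2)^2 - (k+1)^2)]. The term with [g]
    is estimated by [g (k+2) / (k+2+a) <= g], with a weight [(k-2) (k+2)] that is nonnegative from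
    [k = 2] on. *)
Lemma decay_gapS a g k : 0 <= a -> 0 <= g -> g <= 3 / 2 -> (2 <= k)%N ->
  decay_gap a g k + decay a g k *
    ((2 * k%:R + 3) * (k%:R - 3) - g * (k%:R - 2) * (k%:R + 2))
  <= decay_gap a g k.+1.
Proof.
move=> a0 g0 g1 k2; rewrite /decay_gap decay_sumS decayS -(natr1 k).
have q0 := decay_gt0 k a0 g0 g1.
have : 2 <= k%:R :> R by rewrite ler_nat.
move: (k%:R : R) (decay _ _ _) (decay_sum _ _ _) q0 => m q T q0 m2.
have h : g / (m + 2 + a) * (m + 2) <= g.
  rewrite mulrAC ler_pdivrMr; last by lra.
  by apply: ler_wpM2l => //; lra.
have : 0 <= q * ((m - 2) * (m + 2) * (g - g / (m + 2 + a) * (m + 2))).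
  by rewrite mulr_ge0 ?(ltW q0)// !mulr_ge0// ?subr_ge0//; lra.
move: (g / _) h => t h ?; lra.
Qed.

(* [decay_gapS] shows that the gap can decrease only for 3 <= k <= 6, and by at
   most a multiple of [decay a g 3 * g].  For g <= 11/12 it decreases only at
   k = 3; for g >= 11/12 the bound [decay a g 3 <= 47/100] makes the total
   decrease smaller than [decay_gap a g 3 >= 25 * (g / (2 + a))]. *)
Lemma decay_gap_ge0 a g k : 0 <= a -> a <= 5 / 4 -> 0 <= g -> g <= 3 / 2 ->
  (1 <= k)%N -> 0 <= decay_gap a g k.
Proof.
move=> a0 a1 g0 g1.
have q0 n := ltW (decay_gt0 n a0 g0 g1).
have qS n := decayS_le n a0 g0 g1.
have gapS n := @decay_gapS a g n a0 g0 g1.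
have T0 : decay_sum a g 0 = 0 by rewrite /decay_sum big_ord0.
have T1 : decay_sum a g 1 = 4 by rewrite decay_sumS T0 decay0; lra.
have T2 : decay_sum a g 2 = 4 + 9 * decay a g 1 by rewrite decay_sumS T1; lra.
have T3 : decay_sum a g 3 = 4 + 9 * decay a g 1 + 16 * decay a g 2.
  by rewrite decay_sumS T2; lra.
have q1 : decay a g 1 = 1 - g / (2 + a) by rewrite decayS decay0 mul1r add0r.
have D1 : 0 <= decay_gap a g 1.
  by rewrite /decay_gap T1; have := qS 0; rewrite decay0 => ?; lra.
have D2 : 0 <= decay_gap a g 2.
  by rewrite /decay_gap T2; have := qS 0; have ? := qS 1; rewrite decay0 => ?; lra.
(* The cubic term vanishes at [k = 3], and the gap [25 - 9 decay_1 - 16 decay_2] is bounded by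
   [decay_2 <= decay_1 = 1 - g / (2+a)]. *)
have D3 : 25 * (g / (2 + a)) <= decay_gap a g 3.
  by rewrite /decay_gap T3; have := qS 1; rewrite q1 => ?; lra.
(* [4/13] is [1 / (2 + 5/4)], the worst case [a = 5/4]. *)
have g4 : 4 / 13 * g <= g / (2 + a).
  by rewrite mulrC; apply: ler_wpM2l => //; rewrite -[leLHS]invf_div lef_pV2 ?posrE; lra.
have q3le k' : (3 <= k')%N -> decay a g k' <= decay a g 3.
  elim: k' => // k' IH; rewrite leq_eqVlt => /orP[/eqP <- //|k3].
  by apply: le_trans (qS k') (IH k3).
have D4 : 100 / 13 * g - 5 * g * decay a g 3 <= decay_gap a g 4.
  have := gapS 3 isT; move: D3 g4.
  by move: (decay_gap _ _ _) (decay_gap _ _ _) (decay _ _ _) => *; lra.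
have D4_ge0 : 0 <= decay_gap a g 4.
  apply: le_trans D4; have : decay a g 3 <= 1.
    by rewrite -(decay0 a g); do 3 (apply: le_trans (qS _) _ => //).
  move: (decay a g 3) => q q1'.
  have : 0 <= g * (1 - q) by rewrite mulr_ge0// subr_ge0.
  lra.
(* The increment at [k = 4] has the factor [11 - 12 g], whence the threshold [11/12]; at [k = 7] it
   is [68 - 45 g], positive for all [g <= 3/2]. *)
have step k' : (4 <= k')%N -> g <= 11 / 12 \/ (7 <= k')%N ->
    0 <= decay_gap a g k' -> 0 <= decay_gap a g k'.+1.
  move=> k4 gk Dk; apply: le_trans (gapS k' (ltnW (ltnW k4))).
  apply: addr_ge0 => //; apply: mulr_ge0 => //.
  have : 4 <= k'%:R :> R by rewrite ler_nat.
  have : g <= 11 / 12 \/ 7 <= k'%:R :> R by rewrite ler_nat.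
  move: (k'%:R : R) => m [gs|m7] m4.
    have h1 : 0 <= (11 / 12 - g) * ((m - 2) * (m + 2)) by rewrite !mulr_ge0//; lra.
    have h2 := sqr_ge0 (m - 4); lra.
  have h1 : 0 <= (3 / 2 - g) * ((m - 2) * (m + 2)) by rewrite !mulr_ge0//; lra.
  have h2 := sqr_ge0 (m - 7); lra.
have [gs|gl] := leP g (11 / 12).
  case: k => [|[|[|[|k]]]] // _.
    by apply: le_trans D3; rewrite mulr_ge0// divr_ge0//; lra.
  elim: k => // k IH; apply: step => //; by left.
(* The worst case is [g = 11/12], [a = 5/4], where the factors are [1 - 11 / (12 j + 39)] for
   [j = 0, 1, 2]. *)
have q3 : decay a g 3 <= 47 / 100.
  have f (j c : R) : 0 <= j -> 0 < c -> c * (j + 2 + 5 / 4) <= 11 / 12 ->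
      1 - g / (j + 2 + a) <= 1 - c.
    move=> j0 c0 jc; rewrite lerD2l lerN2 ler_pdivlMr; last by lra.
    have : 0 <= c * (5 / 4 - a) by rewrite mulr_ge0 ?(ltW c0)// subr_ge0.
    lra.
  have p j := @decay_factor_bounds a g j a0 g0 g1.
  rewrite !decayS decay0 mul1r.
  apply: (@le_trans _ _ ((1 - 11 / 39) * (1 - 11 / 51) * (1 - 11 / 63))); last by lra.
  have /andP[/ltW p0 _] := p 0%N; have /andP[/ltW p1 _] := p 1%N.
  have /andP[/ltW p2 _] := p 2%N.
  apply: ler_pM => //; [exact: mulr_ge0|apply: ler_pM => //; apply: f => //; lra|].
  by apply: f => //; lra.
have q30 : 0 <= decay a g 3 by [].
(* Used with [c = 14/3, 11/3, 2] at [j = 4, 5, 6]: the least constants valid up to [g = 3/2]. *)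
have big j (c : R) : (3 <= j)%N -> 0 <= c ->
    (2 * j%:R + 3) * (j%:R - 3) - g * (j%:R - 2) * (j%:R + 2) >= - c * g ->
    - c * g * decay a g 3 <= decay a g j *
      ((2 * j%:R + 3) * (j%:R - 3) - g * (j%:R - 2) * (j%:R + 2)).
  move=> j3 c0 h; apply: (@le_trans _ _ (decay a g j * (- c * g))).
    have : 0 <= c * g * (decay a g 3 - decay a g j).
      by rewrite mulr_ge0 ?subr_ge0 ?q3le// mulr_ge0.
    lra.
  exact: ler_wpM2l.
have gq : g * decay a g 3 <= g * (47 / 100) by exact: ler_wpM2l.
have D5 : (100 / 13 - (5 + 14 / 3) * (47 / 100)) * g <= decay_gap a g 5.
  have := gapS 4 isT; have := big 4 (14 / 3) isT ltac:(lra) ltac:(lra).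
  move: (decay a g 4 * _) => t *; lra.
have D6 : (100 / 13 - (5 + 14 / 3 + 11 / 3) * (47 / 100)) * g <= decay_gap a g 6.
  have := gapS 5 isT; have := big 5 (11 / 3) isT ltac:(lra) ltac:(lra).
  move: (decay a g 5 * _) => t *; lra.
have D7 : (100 / 13 - (5 + 14 / 3 + 11 / 3 + 2) * (47 / 100)) * g <= decay_gap a g 7.
  have := gapS 6 isT; have := big 6 2 isT ltac:(lra) ltac:(lra).
  move: (decay a g 6 * _) => t *; lra.
have D7_ge0 : 0 <= decay_gap a g 7 by apply: le_trans D7; lra.
case: k => [|[|[|[|[|[|[|k]]]]]]] // _.
- by apply: le_trans D3; rewrite mulr_ge0// divr_ge0//; lra.
- by apply: le_trans D5; lra.
- by apply: le_trans D6; lra.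
- by elim: k => // k IH; apply: step => //; right.
Qed.

End Decay.

(** * The Gamma quotient as an inverse product, and its power growth *)

Section Beta.
Context {R : realType}.
Implicit Types (a x eta g v : R) (k n : nat).

(** By [GammaS], passing from [n] to [n + 1] multiplies [beta] by [(n+2+a) / (n+3-a-x-eta)], the
    inverse of the next factor of [decay]. *)
Lemma beta_decay a x eta n : 0 <= a -> 0 < 3 - a - x - eta ->
  0 <= 2 * a + x + eta - 1 -> 2 * a + x + eta - 1 <= 3 / 2 ->
  beta a x eta n = (decay a (2 * a + x + eta - 1) n)^-1.
Proof.
move=> a0 c0 g0 g1; have s3 : 0 < 2 + a by lra.
have G3 := lt0r_neq0 (Gamma_gt0 s3); have G4 := lt0r_neq0 (Gamma_gt0 c0).
elim: n => [|n IH].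
  by rewrite decay0 /beta !add0r (divff G3) (divff G4) divr1 invr1.
have n0 : 0 <= n%:R :> R by [].
have s1 : 0 < n%:R + 2 + a by lra.
have s2 : 0 < n%:R + 3 - a - x - eta by lra.
rewrite decayS [RHS]invfM -IH /beta -(natr1 n).
rewrite (_ : n%:R + 1 + 2 + a = (n%:R + 2 + a) + 1); last by ring.
rewrite (_ : n%:R + 1 + 3 - a - x - eta = (n%:R + 3 - a - x - eta) + 1); last by ring.
rewrite (GammaS s1) (GammaS s2).
rewrite (_ : 1 - _ / (n%:R + 2 + a) = (n%:R + 3 - a - x - eta) / (n%:R + 2 + a)); last first.
  by rewrite -[X in X - _](divff (lt0r_neq0 s1)) -mulrBl; congr (_ / _); ring.
have := lt0r_neq0 (Gamma_gt0 s1); have := lt0r_neq0 (Gamma_gt0 s2).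
move: (Gamma _) (Gamma _) (Gamma (2 + a)) (Gamma (3 - a - x - eta)) G3 G4.
move: (n%:R + 2 + a) (n%:R + 3 - a - x - eta) (lt0r_neq0 s1) (lt0r_neq0 s2).
move=> p q p0 q0 A B C D C0 D0 A0 B0.
by field; do ![apply/andP; split => //].
Qed.

Lemma beta_gt0 a x eta n : 0 <= a -> 0 < 3 - a - x - eta ->
  0 <= 2 * a + x + eta - 1 -> 2 * a + x + eta - 1 <= 3 / 2 ->
  0 < beta a x eta n.
Proof. by move=> a0 c0 g0 g1; rewrite beta_decay// invr_gt0 decay_gt0. Qed.

(* [1 + g/v <= exp(g/v)] and [1 - 1/v <= exp(-1/v)]. *)
Lemma growth_factor_le g v : 0 <= g -> 1 < v ->
  (1 - g / (v + g))^-1 <= (v / (v - 1)) `^ g.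
Proof.
move=> g0 v1; have -> : (1 - g / (v + g))^-1 = 1 + v^-1 * g by field; lra.
apply: le_trans (expR_ge1Dx _) _; rewrite expRM.
apply: ge0_ler_powR => //; rewrite ?nnegrE ?expR_ge0//.
  by rewrite divr_ge0//; lra.
rewrite -[leRHS]invrK -[leLHS]invrK -expRN.
rewrite lef_pV2 ?posrE ?expR_gt0 ?invr_gt0 ?divr_gt0//; try lra.
rewrite invf_div; have := expR_ge1Dx (- v^-1).
by rewrite (_ : (v - 1) / v = 1 - v^-1)//; field; lra.
Qed.

(** The bounds of [growth_factor_le] with [v = k + 2 + a - g] telescope over [k >= 1]. The factor
    [k = 0] is kept exact, since there [v > 1] may fail. *)
Lemma decay_inv_le a g n : 0 <= a -> 0 <= g -> g <= 3 / 2 ->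
  (decay a g n.+1)^-1 <=
    (2 + a) / (2 + a - g) * ((n%:R + 2 + a - g) / (2 + a - g)) `^ g.
Proof.
move=> a0 g0 g1; have v1 : 0 < 2 + a - g by lra.
elim: n => [|n IH].
  rewrite decayS decay0 add0r mul1r divff ?gt_eqF// powR1 mulr1.
  by rewrite (_ : (1 - _)^-1 = (2 + a) / (2 + a - g))//; field; lra.
have n0 : 0 <= n%:R :> R by [].
rewrite decayS invfM -(natr1 n).
have -> : (n%:R + 1 + 2 + a - g) / (2 + a - g) =
    ((n%:R + 2 + a - g) / (2 + a - g)) *
    ((n%:R + 3 + a - g) / (n%:R + 3 + a - g - 1)) by field; lra.
rewrite powRM ?divr_ge0//; try lra.
rewrite mulrA; apply: ler_pM => //.
- by rewrite invr_ge0 ltW// decay_gt0.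
- by have /andP[/ltW] := decay_factor_bounds n.+1 a0 g0 g1; rewrite -(natr1 n) invr_ge0.
have -> : n%:R + 1 + 2 + a = n%:R + 3 + a - g + g by ring.
by apply: growth_factor_le => //; lra.
Qed.

End Beta.

(** * From energy estimates to the error bounds *)

Section Bounds.
Context {R : realType}.
Implicit Types (alpha x eta : R) (e z : nat -> R) (n : nat).

Lemma max_sqr_ge z n s : (1 <= s <= n)%N -> z s ^+ 2 <= max_sqr z n.
Proof.
by move=> sn; apply: (@le_bigmax_seq _ _ _ _ _ _ _ (fun s => z s ^+ 2));
  rewrite // mem_index_iota ltnS.
Qed.

Lemma max_sqr_ge0 z n : 0 <= max_sqr z n.
Proof. exact: bigmax_ge_id. Qed.

Lemma max_err_ge0 e z n : 0 <= max_err e z n.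
Proof. by apply: le_trans (bigmax_ge_id _ _ _ _); exact: normr_ge0. Qed.

Lemma max_sqr_le_max_err e z n : max_sqr z n <= max_err e z n ^+ 2.
Proof.
rewrite /max_sqr big_seq; apply: bigmax_le => [|s]; first exact: sqr_ge0.
rewrite mem_index_iota => sn; rewrite -real_normK ?num_real// ler_sqr ?nnegrE ?max_err_ge0//.
by apply: (@le_bigmax_seq _ _ _ _ _ _ _ (fun s => `|z s|)) => //; rewrite mem_index_iota.
Qed.

Lemma sqr_le_max_err e z n : e 1%N ^+ 2 <= max_err e z n ^+ 2.
Proof.
by rewrite -real_normK ?num_real// ler_sqr ?nnegrE ?max_err_ge0//; exact: bigmax_ge_id.
Qed.

(** The radicand is at most [(p^2 + q^2) M^2 / x], and [p^2 + q^2 <= (p + q)^2]. *)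
Lemma sqrt_bound_le x (A C p q y w M : R) : 0 < x -> 0 <= p -> 0 <= q ->
  A <= p ^+ 2 -> C <= q ^+ 2 -> y ^+ 2 <= M ^+ 2 -> 0 <= w -> w <= M ^+ 2 -> 0 <= M ->
  Num.sqrt (1 / `|x| * (A * y ^+ 2 + C * w)) <= (p + q) * (M / `|x| `^ (1 / 2)).
Proof.
move=> x0 p0 q0 Ap Cq yM w0 wM M0.
have rhs0 : 0 <= (p + q) * (M / `|x| `^ (1 / 2)).
  by rewrite mulr_ge0 ?addr_ge0// divr_ge0// powR_ge0.
rewrite -[leRHS](ger0_norm rhs0) -[leRHS]sqrtr_sqr; apply: ler_wsqrtr.
rewrite (gtr0_norm x0) (div1r 2) powR12_sqrt ?(ltW x0)//.
rewrite !exprMn exprVn sqr_sqrtr ?(ltW x0)//.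
rewrite (_ : (p + q) ^+ 2 * _ = 1 / x * ((p + q) ^+ 2 * M ^+ 2)); last by ring.
apply: ler_wpM2l; first by rewrite div1r invr_ge0 ltW.
apply: (@le_trans _ _ (p ^+ 2 * M ^+ 2 + q ^+ 2 * M ^+ 2)).
  apply: lerD.
    by apply: le_trans (ler_wpM2r (sqr_ge0 y) Ap) _; rewrite ler_wpM2l ?sqr_ge0.
  by apply: le_trans (ler_wpM2r w0 Cq) _; rewrite ler_wpM2l ?sqr_ge0.
rewrite -mulrDl; apply: ler_wpM2r; first exact: sqr_ge0.
by have := mulr_ge0 p0 q0; lra.
Qed.

Lemma powR_sqr (a r : R) : (a `^ r) ^+ 2 = a `^ (r * 2).
Proof. by rewrite -powR_mulrn ?powR_ge0// -powRrM. Qed.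

Lemma error_le_sqrt_energy alpha x e n (E : R) : -1 < alpha -> 0 < x ->
  energy alpha x e n.+1 <= E -> `|e n.+1| <= Num.sqrt (1 / `|x| * E).
Proof.
move=> a1 x0 hE; rewrite -[leLHS]sqrtr_sqr; apply: ler_wsqrtr.
apply: le_trans (error_sqr_le_energy e n a1 x0) _.
by rewrite (gtr0_norm x0) div1r; apply: ler_wpM2l => //; rewrite invr_ge0 ltW.
Qed.

Lemma contractive_bound alpha x e z n : -1 < alpha -> 0 < x ->
  alpha <= 1 / 4 -> x < 1 / 4 -> e 0%N = 0 -> three_term alpha x e z -> (1 <= n)%N ->
  let B := Num.sqrt (1 / `|x| * ((1 + alpha + x) * e 1%N ^+ 2 +
             2 * (n%:R + 1) * (n%:R + 2) * (2 * n%:R + 3) / 3 * max_sqr z n)) in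
  `|e n.+1| <= B /\
  B <= (2 + 2 * (n%:R + 2) `^ (3 / 2) / Num.sqrt 3) * (max_err e z n / `|x| `^ (1 / 2)).
Proof.
move=> a1 x0 a14 x14 e0 e_rec n1 B; split.
  apply: (error_le_sqrt_energy a1 x0); have xa : x + 2 * alpha - 1 <= - (1 / 4) by lra.
  apply: le_trans (energy_le_contractive a1 e_rec xa (@max_sqr_ge z n)) _.
  rewrite energy1// lerD2l; apply: ler_wpM2r; first exact: max_sqr_ge0.
  lra.
have n0 : 0 <= n%:R :> R by [].
apply: sqrt_bound_le => //.
- lra.
- rewrite expr_div_n sqr_sqrtr// exprMn powR_sqr.
  rewrite (_ : 3 / 2 * 2 = 3%:R); last by field.
  rewrite powR_mulrn; last by lra.
  rewrite ler_pM2r ?invr_gt0//.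
  (* The two sides differ by [2 (n+2) (3n+5)]. *)
  have : 0 <= (n%:R + 2) * (3 * n%:R + 5 : R) by rewrite mulr_ge0//; lra.
  lra.
- exact: sqr_le_max_err.
- exact: max_sqr_ge0.
- exact: max_sqr_le_max_err.
- exact: max_err_ge0.
Qed.

(** A discrete Gronwall argument: [decay] is the integrating factor that makes the one-step
    inequalities telescope. *)
Lemma energy_le_expansive alpha x eta e z M n : 0 <= alpha -> 0 < x -> 0 < eta ->
  0 <= 2 * alpha + x + eta - 1 -> 2 * alpha + x + eta - 1 <= 3 / 2 ->
  three_term alpha x e z -> (forall s, (1 <= s <= n)%N -> z s ^+ 2 <= M) ->
  decay alpha (2 * alpha + x + eta - 1) n * energy alpha x e n.+1 <=
    energy alpha x e 1 + M / eta * decay_sum alpha (2 * alpha + x + eta - 1) n.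
Proof.
set g := 2 * alpha + x + eta - 1; move=> a0 x0 eta0 g0 g1 e_rec.
elim: n => [_|n IH zM].
  by rewrite decay0 mul1r /decay_sum big_ord0 mulr0 addr0.
have {}IH := IH (fun s h => zM s ltac:(by case/andP: h => -> /leqW)).
have a1 : -1 < alpha by lra.
have xa : 0 <= x + 2 * alpha - 1 + eta by move: g0; rewrite /g; lra.
have := energy_step_expansive a1 x0 e_rec (ltn0Sn n) eta0 xa.
have := zM n.+1; rewrite leqnn => /(_ isT) zMn.
rewrite -/g decayS decay_sumS -(natr1 n) (_ : n%:R + 1 + 1 = n%:R + 2); last by ring.
have q0 := decay_gt0 n a0 g0 g1.
move=> /(ler_wpM2l (ltW q0)); rewrite mulrA => /le_trans; apply.
rewrite [leLHS]mulrDr [X in _ <= _ + X]mulrDr [leRHS]addrA; apply: lerD => //.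
rewrite (_ : M / eta * _ = decay alpha g n * ((n%:R + 2) ^+ 2 / eta * M)); last by ring.
apply: ler_wpM2l; first exact: ltW.
by apply: ler_wpM2l => //; rewrite divr_ge0 ?sqr_ge0// ltW.
Qed.

Lemma expansive_bound alpha x eta e z n : 0 <= alpha -> 0 < x -> 0 < eta ->
  0 < 3 - alpha - x - eta ->
  0 <= 2 * alpha + x + eta - 1 -> 2 * alpha + x + eta - 1 <= 3 / 2 ->
  e 0%N = 0 -> three_term alpha x e z -> (1 <= n)%N ->
  let b := beta alpha x eta in
  let B := Num.sqrt (1 / `|x| *
                       (b n * (1 + alpha + x) * e 1%N ^+ 2 +
                        (29 * b n + (n%:R - 3) * (n%:R + 1) ^+ 2) / eta
                          * max_sqr z n)) in
  `|e n.+1| <= B /\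
  B <= (2 * Num.sqrt (b n) + (11 / 2 * Num.sqrt (b n) + n%:R `^ (1 / 2) * (n%:R + 1))
                    / Num.sqrt eta)
                 * (max_err e z n / `|x| `^ (1 / 2)).
Proof.
move=> a0 x0 eta0 c0 g0 g1 e0 e_rec n1 b B.
have b0 : 0 < b n by exact: beta_gt0.
have n0 : 0 <= n%:R :> R by [].
split.
  have a1 : -1 < alpha by lra.
  apply: (error_le_sqrt_energy a1 x0).
  have := energy_le_expansive a0 x0 eta0 g0 g1 e_rec (@max_sqr_ge z n).
  (* From [2 alpha + x + eta <= 5/2] with [x] and [eta] positive. *)
  have a54 : alpha <= 5 / 4 by lra.
  have := decay_gap_ge0 a0 a54 g0 g1 n1; rewrite /decay_gap subr_ge0.
  have qE : decay alpha (2 * alpha + x + eta - 1) n = (b n)^-1.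
    by rewrite /b beta_decay// invrK.
  rewrite qE (energy1 _ _ e0) => gap; rewrite ler_pdivrMl// => /le_trans; apply.
  rewrite [leRHS](_ : _ = b n * ((1 + alpha + x) * e 1%N ^+ 2 + max_sqr z n / eta *
    (29 + (n%:R - 3) * (n%:R + 1) ^+ 2 * (b n)^-1))); last by field; rewrite !gt_eqF.
  rewrite ler_pM2l// lerD2l; apply: ler_wpM2l => //.
  by rewrite divr_ge0 ?max_sqr_ge0// ltW.
have sb0 := sqrtr_ge0 (b n); have se0 := sqrtr_ge0 eta.
apply: sqrt_bound_le => //.
- rewrite exprMn sqr_sqrtr ?(ltW b0)// mulrC; apply: ler_wpM2r; first exact: ltW.
  (* [1 + alpha + x < 4] because [3 - alpha - x - eta > 0]. *)
  lra.
- rewrite expr_div_n sqr_sqrtr ?(ltW eta0)//; apply: ler_wpM2r; first by rewrite invr_ge0 ltW.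
  rewrite [leRHS]sqrrD !exprMn sqr_sqrtr ?(ltW b0)// powR_sqr.
  rewrite (_ : 1 / 2 * 2 = 1); last by field.
  rewrite powRr1//.
  (* The square of the sum has a nonnegative cross term, [(11/2)^2 = 121/4] exceeds 29, and
     [n (n+1)^2] exceeds [(n-3) (n+1)^2]. *)
  have h1 : 0 <= Num.sqrt (b n) * (n%:R `^ (1 / 2) * (n%:R + 1)).
    by rewrite !mulr_ge0 ?powR_ge0//; lra.
  have h2 : 0 <= (n%:R + 1 : R) ^+ 2 by rewrite sqr_ge0.
  have h3 : 0 <= (121 / 4 - 29) * b n by rewrite mulr_ge0 ?(ltW b0)//; lra.
  have h4 : 0 <= (n%:R + 1 : R) ^+ 2 * 3 by rewrite mulr_ge0.
  lra.
- exact: sqr_le_max_err.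
- exact: max_sqr_ge0.
- exact: max_sqr_le_max_err.
- exact: max_err_ge0.
Qed.
End Bounds.

(** * Asymptotics of [beta], and uniform constants for [alpha = 1] *)

Section Growth.
Context {R : realType}.
Implicit Types (alpha x eta : R) (n : nat).

Lemma beta_le_powR alpha x eta n : 0 <= alpha -> 0 < 3 - alpha - x - eta ->
  0 <= 2 * alpha + x + eta - 1 -> 2 * alpha + x + eta - 1 <= 3 / 2 -> (1 <= n)%N ->
  beta alpha x eta n <= (2 + alpha) / (3 - alpha - x - eta) *
    ((n%:R + 2 - alpha - x - eta) / (3 - alpha - x - eta)) `^ (2 * alpha + x + eta - 1).
Proof.
move=> a0 c0 g0 g1; case: n => // n _; rewrite beta_decay//.
apply: le_trans (decay_inv_le n a0 g0 g1) _.
rewrite (_ : 2 + alpha - _ = 3 - alpha - x - eta); last by ring.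
rewrite (_ : n%:R + 2 + alpha - _ = n.+1%:R + 2 - alpha - x - eta)//.
by rewrite -(natr1 n); ring.
Qed.

(** Since [g >= 0], [n + 2 - alpha - x - eta = n + 1 + alpha - g] is at most [n + 1 + alpha]; the
    denominator [c] goes into the constant. *)
Lemma beta_eqO alpha x eta : 0 <= alpha -> 0 < 3 - alpha - x - eta ->
  0 <= 2 * alpha + x + eta - 1 -> 2 * alpha + x + eta - 1 <= 3 / 2 ->
  beta alpha x eta =O_\oo (fun n => (n%:R + 1 + alpha) `^ (2 * alpha + x + eta - 1)).
Proof.
move=> a0 c0 g0 g1; apply/eqO_exP.
set c := 3 - alpha - x - eta; set g := 2 * alpha + x + eta - 1.
exists ((2 + alpha) / c * c^-1 `^ g).
  by rewrite mulr_gt0 ?powR_gt0 ?invr_gt0// divr_gt0//; lra.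
near=> n; have n1 : (1 <= n)%N by near: n; exact: nbhs_infty_ge.
have n0 : 1 <= n%:R :> R by rewrite ler1n.
rewrite !ger0_norm ?powR_ge0 ?(ltW (beta_gt0 _ _ _ _ _))//.
apply: le_trans (beta_le_powR a0 c0 g0 g1 n1) _; rewrite -/c -/g.
rewrite -[leRHS]mulrA; apply: ler_wpM2l; first by rewrite divr_ge0 ?ltW//; lra.
have vn : 0 <= n%:R + 2 - alpha - x - eta by move: c0; rewrite /c; lra.
rewrite powRM ?invr_ge0 ?(ltW c0)// [leLHS]mulrC; apply: ler_wpM2l; first exact: powR_ge0.
apply: ge0_ler_powR => //; rewrite ?nnegrE//; first by lra.
by move: g0; rewrite /g; lra.
Unshelve. all: by end_near. Qed.

(** Uniform in [x < 1/4]: the denominator [7/4 - x] exceeds [3/2], the base is at most [n], and the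
    exponent [5/4 + x] is below [3/2]. *)
Lemma beta_one_le x n : 0 < x -> x < 1 / 4 -> (1 <= n)%N ->
  beta 1 x (1 / 4) n <= 2 * n%:R `^ (3 / 2).
Proof.
move=> x0 x14 n1; have n1R : 1 <= n%:R :> R by rewrite ler1n.
have c0 : 0 < 3 - 1 - x - 1 / 4 by lra.
apply: le_trans (beta_le_powR _ c0 _ _ n1) _ => //; try lra.
apply: ler_pM; rewrite ?powR_ge0//.
- by rewrite divr_ge0 ?(ltW c0)//; lra.
- by rewrite ler_pdivrMr//; lra.
apply: (@le_trans _ _ (n%:R `^ (2 * 1 + x + 1 / 4 - 1))); last first.
  by apply: ler_powR => //; lra.
apply: ge0_ler_powR => //; rewrite ?nnegrE ?divr_ge0 ?(ltW c0)//; try lra.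
rewrite ler_pdivrMr//.
have : 0 <= (n%:R - 1) * (3 - 1 - x - 1 / 4 - 1) :> R by rewrite mulr_ge0//; lra.
lra.
Qed.

Lemma sqrt_beta_one_le x n : 0 < x -> x < 1 / 4 -> (1 <= n)%N ->
  Num.sqrt (beta 1 x (1 / 4) n) <= 3 / 2 * n%:R `^ (3 / 4).
Proof.
move=> x0 x14 n1; have rhs0 : 0 <= 3 / 2 * n%:R `^ (3 / 4) :> R.
  by rewrite mulr_ge0 ?powR_ge0//; lra.
rewrite -[leRHS](ger0_norm rhs0) -[leRHS]sqrtr_sqr; apply: ler_wsqrtr.
apply: le_trans (beta_one_le x0 x14 n1) _; rewrite exprMn powR_sqr.
rewrite (_ : 3 / 4 * 2 = 3 / 2 :> R); last by field.
by apply: ler_wpM2r; [exact: powR_ge0|lra].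
Qed.

Lemma sqrt14 : Num.sqrt (1 / 4) = 1 / 2 :> R.
Proof.
rewrite (_ : 1 / 4 = (1 / 2) ^+ 2 :> R); last by field.
by rewrite sqrtr_sqr ger0_norm//; lra.
Qed.

(** Dividing by [sqrt (1/4)] doubles, so the first group is [13 sqrt beta <= (39/2) n^(3/4)]; the
    second uses [n + 1 <= 2 n]. *)
Lemma beta_one_terms_le x n : 0 < x -> x < 1 / 4 -> (1 <= n)%N ->
  2 * Num.sqrt (beta 1 x (1 / 4) n) +
    11 / 2 * Num.sqrt (beta 1 x (1 / 4) n) / Num.sqrt (1 / 4) <= 20 * n%:R `^ (3 / 4) /\
  n%:R `^ (1 / 2) * (n%:R + 1) / Num.sqrt (1 / 4) <= 4 * n%:R `^ (3 / 2) :> R.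
Proof.
move=> x0 x14 n1; have n1R : 1 <= n%:R :> R by rewrite ler1n.
have n0R : 0 < n%:R :> R by lra.
rewrite sqrt14 (_ : (1 / 2)^-1 = 2 :> R); last by field.
have p0 : 0 <= n%:R `^ (3 / 4) :> R by exact: powR_ge0.
split; first by have h := sqrt_beta_one_le x0 x14 n1; lra.
rewrite (_ : 3 / 2 = 1 / 2 + 1 :> R); last by field.
rewrite (@powRD _ n%:R); last by rewrite (gt_eqF n0R) implybT.
rewrite powRr1 ?(ltW n0R)//.
have : 0 <= n%:R `^ (1 / 2) * (n%:R - 1) :> R by rewrite mulr_ge0 ?powR_ge0// subr_ge0.
lra.
Qed.

End Growth.

Theorem theorem3p1 (R : realType) :
  [/\ (* (i) *)
      forall (alpha x etax : R) (etaa etab e : nat -> R),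
        -1 < alpha -> 0 < x ->
        error_sequence alpha x etax etaa etab e ->
        alpha <= 1 / 4 -> x < 1 / 4 ->
        let z := zeta alpha x etax etaa etab e in
        forall n : nat, (1 <= n)%N ->
          let B := Num.sqrt (1 / `|x| *
                     ((1 + alpha + x) * e 1%N ^+ 2 +
                      2 * (n%:R + 1) * (n%:R + 2) * (2 * n%:R + 3) / 3
                        * max_sqr z n)) in
          `|e n.+1| <= B /\
          B <= (2 + 2 * (n%:R + 2) `^ (3 / 2) / Num.sqrt 3)
               * (max_err e z n / `|x| `^ (1 / 2)),
      (* (ii) *)
      forall alpha x eta : R,
        0 <= alpha -> 0 < x -> 0 < eta ->
        0 < 3 - alpha - x - eta ->
        - (3 / 2) <= 1 - 2 * alpha - x - eta ->
        1 - 2 * alpha - x - eta < 0 ->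
        let b := beta alpha x eta in
        (forall (etax : R) (etaa etab e : nat -> R),
          error_sequence alpha x etax etaa etab e ->
          let z := zeta alpha x etax etaa etab e in
          forall n : nat, (1 <= n)%N ->
            let B := Num.sqrt (1 / `|x| *
                       (b n * (1 + alpha + x) * e 1%N ^+ 2 +
                        (29 * b n + (n%:R - 3) * (n%:R + 1) ^+ 2) / eta
                          * max_sqr z n)) in
            `|e n.+1| <= B /\
            B <= (2 * Num.sqrt (b n) +
                  (11 / 2 * Num.sqrt (b n) + n%:R `^ (1 / 2) * (n%:R + 1))
                    / Num.sqrt eta)
                 * (max_err e z n / `|x| `^ (1 / 2))) /\
        b =O_\oo (fun n : nat =>
                    (n%:R + 1 + alpha) `^ (2 * alpha + x + eta - 1)) &
      (* (iii): the O(n^(3/4)) and O(n^(3/2)) terms are the two groups of terms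
         of the bound in (ii) for alpha = 1 and eta = 1/4 *)
      exists C1 C2 C3 : R,
        (forall (x : R) (n : nat), 0 < x -> x < 1 / 4 -> (1 <= n)%N ->
          2 * Num.sqrt (beta 1 x (1 / 4) n) +
            11 / 2 * Num.sqrt (beta 1 x (1 / 4) n) / Num.sqrt (1 / 4)
            <= C1 * n%:R `^ (3 / 4) /\
          n%:R `^ (1 / 2) * (n%:R + 1) / Num.sqrt (1 / 4)
            <= C2 * n%:R `^ (3 / 2)) /\
        forall (x etax : R) (etaa etab e : nat -> R),
          0 < x -> x < 1 / 4 ->
          error_sequence 1 x etax etaa etab e ->
          let z := zeta 1 x etax etaa etab e in
          forall n : nat, (1 <= n)%N ->
            `|e n.+1| <= (C1 * n%:R `^ (3 / 4) + C2 * n%:R `^ (3 / 2))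
                         * (max_err e z n / `|x| `^ (1 / 2)) /\
            (C1 * n%:R `^ (3 / 4) + C2 * n%:R `^ (3 / 2))
              * (max_err e z n / `|x| `^ (1 / 2))
            <= C3 * n%:R `^ (3 / 2)
               * (max_err e z n / `|x| `^ (1 / 2))].
Proof.
split.
- move=> alpha x etax etaa etab e a1 x0 [e0 _ e_rec] a14 x14 z n n1.
  exact: contractive_bound.
- move=> alpha x eta a0 x0 eta0 c0 gl gr b.
  have g0 : 0 <= 2 * alpha + x + eta - 1 by lra.
  have g1 : 2 * alpha + x + eta - 1 <= 3 / 2 by lra.
  split; last exact: beta_eqO.
  by move=> etax etaa etab e [e0 _ e_rec] z n n1; exact: expansive_bound.
(* [24 = 20 + 4], by [n^(3/4) <= n^(3/2)]. *)
exists 20, 4, 24; split => [x n|x etax etaa etab e x0 x14 [e0 _ e_rec] z n n1].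
  exact: beta_one_terms_le.
have [h1 h2] := beta_one_terms_le x0 x14 n1.
have M0 : 0 <= max_err e z n / `|x| `^ (1 / 2).
  by rewrite divr_ge0 ?powR_ge0// max_err_ge0.
have c0 : 0 < 3 - 1 - x - 1 / 4 by lra.
have [eB Bb] : _ /\ _ := @expansive_bound R 1 x (1 / 4) e z n ltac:(lra) x0 ltac:(lra) c0
  ltac:(lra) ltac:(lra) e0 e_rec n1.
split.
  apply: le_trans (le_trans eB Bb) _; apply: ler_wpM2r => //.
  by rewrite [X in _ + X <= _]mulrDl [leLHS]addrA; exact: lerD.
apply: ler_wpM2r => //.
have : n%:R `^ (3 / 4) <= n%:R `^ (3 / 2) :> R.
  by apply: ler_powR; [rewrite ler1n|lra].
lra.
Qed.
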